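(* For all primes $p\equiv 3\pmod{4}$ with $p\geq 5$, all integers $n\geq 0$, and all $r\in\{1,\ldots,p-1\}$, we have $$\sum_{k=-\infty}^\infty (-1)^kB\left(9p^2n+9pr+\dfrac{9(p^2-1)}{4}+2-6k(3k+1)\right)\equiv 0\pmod{3}.$$
   Context: For $m\in\mathbb{N}$ and $|q|<1$ let $f_m:=\prod_{n\geq 1}(1-q^{mn})$. $B(n)$ denotes the number of partition triples $\pi=(\pi_1,\pi_2,\pi_3)$ of $n$ (the sum of all parts of $\pi_1,\pi_2,\pi_3$ is $n$; empty partitions are allowed) such that $\pi_1$ and $\pi_2$ each consist of distinct odd parts and $\pi_3$ consists of parts divisible by $4$. Equivalently, $\sum_{n=0}^\infty B(n)q^n=\dfrac{f_2^4}{f_1^2f_4^3}$. Convention: $B(m)=0$ for every negative integer $m$, so the sum over $k\in\mathbb{Z}$ has only finitely many nonzero terms. *)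

(* Defs.v *)
From HB Require Import structures.
From mathcomp Require Import all_boot all_order all_algebra.
From mathcomp Require Import all_classical.
From mathcomp Require Import zify.

Set Implicit Arguments.
Unset Strict Implicit.
Unset Printing Implicit Defensive.

Import Order.TTheory GRing.Theory Num.Theory.

Local Open Scope nat_scope.

Definition is_partition (s : seq nat) : bool := sorted geq s && (0 \notin s).

Definition partition_triple (n : nat) (t : seq nat * seq nat * seq nat) : bool :=
  let: (s1, s2, s3) := t in
  [&& is_partition s1, is_partition s2, is_partition s3,
      uniq s1 && all odd s1, uniq s2 && all odd s2, all (dvdn 4) s3
    & sumn s1 + sumn s2 + sumn s3 == n].

(* A sum n of positive parts has at most n parts, each at most n, so every
   partition of m <= n is the image of a unique element of part_code n; this
   makes the set of partition triples of n a subset of a finType. *)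
Definition part_code (n : nat) := n.-bseq 'I_n.+1.

Definition parts (n : nat) (b : part_code n) : seq nat := map val b.

Definition triple_parts (n : nat) (t : part_code n * part_code n * part_code n) :
    seq nat * seq nat * seq nat :=
  (parts t.1.1, parts t.1.2, parts t.2).

Definition B (n : nat) : nat :=
  #|[set t : part_code n * part_code n * part_code n
     | partition_triple n (triple_parts t)]|.

Definition Bz (m : int) : int :=
  match m with Posz n => Posz (B n) | Negz _ => Posz 0 end.

Lemma parts_inj (n : nat) : injective (@parts n).
Proof. by move=> b c /(inj_map val_inj) /val_inj. Qed.

Lemma partsK (n : nat) (s : seq nat) :
  is_partition s -> sumn s <= n -> exists b : part_code n, parts b = s.
Proof.
move=> /andP[_ s0] sn.
have sz : size s <= n.
  apply: leq_trans sn; elim: s s0 => //= x s IH.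
  by rewrite inE negb_or => /andP[x0 /IH]; lia.
have le : all (fun x => x < n.+1) s.
  apply/allP => x xs; rewrite ltnS; apply: leq_trans sn.
  elim: s xs {s0 sz} => //= y s IH; rewrite inE => /orP[/eqP->|/IH]; lia.
have sz' : size (map (@inord n) s) <= n by rewrite size_map.
exists (Bseq sz'); rewrite /parts /= -map_comp -[RHS]map_id.
by apply/eq_in_map => x /(allP le) /inordK.
Qed.

(* B n does not depend on the encoding: it is the length of any repetition-free
   enumeration of the partition triples of n. *)
Lemma B_enum (n : nat) (e : seq (seq nat * seq nat * seq nat)) :
  uniq e -> e =i partition_triple n -> B n = size e.
Proof.
move=> ue eP; rewrite /B cardE -(size_map (@triple_parts n)).
apply/perm_size/uniq_perm => //.
  rewrite map_inj_uniq ?enum_uniq //.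
  by move=> [[a b] c] [[a' b'] c'] [/parts_inj-> /parts_inj-> /parts_inj->].
move=> t; rewrite eP; apply/mapP/idP => [[c]|].
  by rewrite mem_enum inE => ct ->.
case: t => [[s1 s2] s3] tP.
have /and5P[p1 p2 p3 _ /and3P[_ _ /eqP sn]] := tP.
have [||b1 E1] := @partsK n s1; [by []|lia|].
have [||b2 E2] := @partsK n s2; [by []|lia|].
have [||b3 E3] := @partsK n s3; [by []|lia|].
exists (b1, b2, b3); last by rewrite /triple_parts /= E1 E2 E3.
by rewrite mem_enum inE /triple_parts /= E1 E2 E3.
Qed.

Local Open Scope ring_scope.

(* \sum_(k \in setT) is 0 by convention when the support is infinite; the
   following shows that this case does not arise. *)
Lemma Bz_finite_support (N : int) :
  finite_set [set k : int | (-1) ^ k * Bz (N - 6 * k * (3 * k + 1)) != 0].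
Proof.
set a : nat := `|N|%N.
apply: (@sub_finite_set _ _ [set` [seq i%:Z - a%:Z | i <- iota 0 a.*2.+1]]).
  move=> k H.
  have {H} : 0 <= N - 6 * k * (3 * k + 1).
    by move: H => /=; case: (N - _) => // m; rewrite mulr0 eqxx.
  move=> H; have ka : - a%:Z <= k <= a%:Z by rewrite /a; nia.
  by apply/mapP; exists (absz ((k : int) + a%:Z)); [rewrite mem_iota|]; lia.
exact: finite_seq.
Qed.

(* Main.v *)
Require Import Defs.
From mathcomp Require Import all_boot all_order all_algebra.
From mathcomp Require Import all_classical.
From mathcomp Require Import finfield zify ring.

(** The alternating sum is a coefficient of a product of two series. Write f_m
    for the product of all 1 - q^(mn) with n >= 1. By Euler's pentagonal number theorem, the sum over k of (-1)^k q^(6k(3k+1)) is f_12, so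
    the sum of the theorem is the coefficient of q^N in
    f_12 * (sum of B(m) q^m), where
    N = 9p^2 n + 9pr + 9(p^2-1)/4 + 2. Reading off the three parts of a partition
    triple, the series of B times f_4 is D^2, where D is the product of all
    1 + q^(2i+1). Modulo 3 the Frobenius map gives f_12 = f_4^3, whence
    f_12 * (sum of B(m) q^m) = f_4^3 * D^2 / f_4 = (f_4 * D)^2,
    and f_4 * D is the series of the triangular numbers: the sum of q^(2k^2+k)
    over all integers k (Gauss).

    So the sum is congruent to the number of pairs (k, l) with
    2k^2 + k + 2l^2 + l = N, that is with (4k+1)^2 + (4l+1)^2 = 8N + 2. But
    8N + 2 = p (p (72n + 18) + 72r) is divisible by p exactly once, because p > 3
    is a prime not dividing r, whereas a prime p = 3 mod 4 that divides a sum
    of two squares divides both, so that p^2 divides the sum: there is no such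
    pair.

    The series are replaced by polynomials modulo X^M with M > N. Both theta identities are cases of Jacobi's triple
    product, which comes from the finite q-binomial theorem ([q_binomial],
    [finite_triple_product], [triple_product_trunc]); the series of B comes from
    an explicit enumeration of partitions with bounded parts and multiplicities
    ([part_enum_gf], [B_gf_trunc]); [pentagonal_B_gf] is the congruence above,
    and [dvdz_sum_squares] is the arithmetic of p. *)

Set Implicit Arguments.
Unset Strict Implicit.
Unset Printing Implicit Defensive.

Import Order.TTheory GRing.Theory Num.Theory.

Local Open Scope ring_scope.

(** * Gaussian binomials and the finite triple product *)

Fixpoint gauss_bin (R : nzRingType) (q : R) (m j : nat) : R :=
  match m, j with
  | _, 0%N => 1
  | 0%N, _.+1 => 0
  | m'.+1, j'.+1 => gauss_bin q m' j + q ^+ (m' - j') * gauss_bin q m' j'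
  end.

Arguments gauss_bin : simpl never.

(** The q-Pochhammer symbol (q; q)_n; f_m is its limit at q^m. *)
Definition qpoch (R : nzRingType) (q : R) (n : nat) : R :=
  \prod_(i < n) (1 - q ^+ i.+1).

Lemma gauss_bin0 (R : nzRingType) (q : R) m : gauss_bin q m 0 = 1.
Proof. by case: m. Qed.

Lemma gauss_binS (R : nzRingType) (q : R) m j :
  gauss_bin q m.+1 j.+1 = gauss_bin q m j.+1 + q ^+ (m - j) * gauss_bin q m j.
Proof. by []. Qed.

Lemma gauss_bin_small (R : nzRingType) (q : R) m j :
  (m < j)%N -> gauss_bin q m j = 0.
Proof.
elim: m j => [|m IH] [|j] // lt_mj.
by rewrite gauss_binS !IH ?mulr0 ?addr0 // ltnW.
Qed.

(** The factorial formula for Gaussian binomials, freed of denominators. Its use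
    is that for j and m - j large all three Pochhammer symbols agree to high
    order, so that [gauss_bin q m j] approaches 1 / (q; q)_oo. *)
Lemma gauss_bin_qpoch (R : comNzRingType) (q : R) m j : (j <= m)%N ->
  gauss_bin q m j * qpoch q j * qpoch q (m - j) = qpoch q m.
Proof.
have PS i : qpoch q i.+1 = qpoch q i * (1 - q ^+ i.+1).
  by rewrite /qpoch big_ord_recr.
have P0 : qpoch q 0 = 1 by rewrite /qpoch big_ord0.
elim: m j => [|m IH] [|j] //; rewrite ?gauss_bin0 ?P0 ?mul1r ?subn0 //.
rewrite ltnS subSS gauss_binS => le_jm.
have e1 := IH j le_jm.
have [lt_jm|ge_jm] := ltnP j m; last first.
  have ejm : j = m by lia.
  by subst j; rewrite gauss_bin_small // PS -[in RHS]e1 subnn P0 expr0; ring.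
have := IH j.+1 lt_jm; rewrite !PS.
have -> : (m - j = (m - j.+1).+1)%N by lia.
move: e1; have -> : (m - j = (m - j.+1).+1)%N by lia.
rewrite !PS => e1 e2.
rewrite -[in RHS]e1.
set d := (m - j.+1)%N in e1 e2 *.
have -> : q ^+ m.+1 = q ^+ d.+1 * q ^+ j.+1 by rewrite -exprD; congr (_ ^+ _); rewrite /d; lia.
have {}e2 : gauss_bin q m j.+1 * (qpoch q j * (1 - q ^+ j.+1)) * qpoch q d =
   gauss_bin q m j * qpoch q j * (qpoch q d * (1 - q ^+ d.+1)) by rewrite e1 e2.
rewrite !mulrDl mulrA [_ * (qpoch q d * _)]mulrA e2; ring.
Qed.

(** Homogeneous in x and y, so that the substitution x = q^n, y = a stands in for
    the non-polynomial y = a q^-n in the proof of the triple product. *)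
Lemma q_binomial (R : comNzRingType) (q x y : R) m :
  \prod_(i < m) (x + y * q ^+ i) =
  \sum_(j < m.+1) gauss_bin q m j * q ^+ 'C(j, 2) * y ^+ j * x ^+ (m - j).
Proof.
elim: m => [|m IH]; first by rewrite big_ord0 big_ord1 gauss_bin0 !mulr1.
rewrite big_ord_recr /= IH [RHS]big_ord_recl mulrDr.
rewrite [X in _ = _ + X](eq_bigr (fun j : 'I_m.+1 =>
   gauss_bin q m j.+1 * q ^+ 'C(j.+1, 2) * y ^+ j.+1 * x ^+ (m - j) +
   gauss_bin q m j * q ^+ 'C(j, 2) * y ^+ j * x ^+ (m - j) * (y * q ^+ m))); last first.
  move=> j _; rewrite lift0 subSS gauss_binS !mulrDl; congr (_ + _).
  have -> : q ^+ m = q ^+ (m - j) * q ^+ j by rewrite -exprD subnK // -ltnS.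
  rewrite binS bin1 exprD exprS; ring.
rewrite big_split addrA -mulr_suml; congr (_ + _).
rewrite big_ord_recl [in RHS]big_ord_recr /= (@gauss_bin_small _ q m m.+1) // !mul0r addr0.
rewrite !gauss_bin0 mulrDl !bin0n !subn0 expr0 !mulr1 !mul1r -exprSr; congr (_ + _).
rewrite mulr_suml; apply: eq_bigr => j _.
by rewrite /bump leq0n add1n -(subnSK (ltn_ord j)) [x ^+ _.+1]exprSr !mulrA.
Qed.

(** With k = j - n, of either sign, [theta_exp n j] is k(k+1)/2 and
    [theta_exp j n] is k(k-1)/2: truncated subtraction kills one of the two
    binomials. Thus [theta_term a b n j] is the term a^(k(k+1)/2) b^(k(k-1)/2)
    of Ramanujan's theta function f(a, b). *)
Definition theta_exp (n j : nat) : nat := ('C((j - n).+1, 2) + 'C(n - j, 2))%N.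

Definition theta_term (R : nzRingType) (a b : R) (n j : nat) : R :=
  a ^+ theta_exp n j * b ^+ theta_exp j n.

Lemma bin2_double m : ('C(m, 2) * 2 + m = m * m)%N.
Proof. by elim: m => // m IH; rewrite binS bin1; lia. Qed.

(** The exponents of a and of b in the j-th term of the q-binomial theorem at
    q = ab, x = q^n, y = a: they are those of the theta term shifted by
    amounts independent of j. *)
Lemma theta_exp_shift n j : (j <= 2 * n)%N ->
  ('C(j, 2) + n * (2 * n - j) + j = n * n + 'C(n, 2) + n + theta_exp n j)%N /\
  ('C(j, 2) + n * (2 * n - j) = n * n + 'C(n, 2) + theta_exp j n)%N.
Proof.
rewrite /theta_exp => le_jn; case: (leqP n j) => [le_nj|/ltnW le_jn'].
  have [d ej] : exists d, j = (d + n)%N by exists (j - n)%N; lia.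
  have [e en] : exists e, n = (d + e)%N by exists (n - d)%N; lia.
  have -> : (n - j = 0)%N by lia.
  have -> : (j - n = d)%N by lia.
  have -> : (2 * n - j = e)%N by lia.
  have := bin2_double j; have := bin2_double n.
  have := bin2_double d; have := bin2_double d.+1.
  by rewrite (@bin_small 1) // (@bin_small 0) // ej en; lia.
have [d en] : exists d, n = (d + j)%N by exists (n - j)%N; lia.
have -> : (n - j = d)%N by lia.
have -> : (j - n = 0)%N by lia.
have -> : (2 * n - j = 2 * d + j)%N by lia.
have := bin2_double j; have := bin2_double n.
have := bin2_double d; have := bin2_double d.+1.
by rewrite (@bin_small 1) // (@bin_small 0) // en; lia.
Qed.

(** Take 2n factors q^n + a q^i with q = ab. For i >= n the factor is
    q^n (1 + a q^(i-n)), for i < n it is a q^i (1 + b q^(n-1-i)), so up to a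
    monomial c their product is the left side; the q-binomial theorem expands it
    as c times the right side, and c cancels. *)
Lemma finite_triple_product (R : idomainType) (a b : R) n : a != 0 -> b != 0 ->
  \prod_(i < n) ((1 + a * (a * b) ^+ i) * (1 + b * (a * b) ^+ i)) =
  \sum_(j < (2 * n).+1) gauss_bin (a * b) (2 * n) j * theta_term a b n j.
Proof.
move=> a0 b0; set q := a * b.
have q0 : q != 0 by rewrite mulf_neq0.
(* The monomial pulled out of the 2n factors; it cancels as a and b are nonzero. *)
set c := q ^+ (n * n + 'C(n, 2)) * a ^+ n.
have c0 : c != 0 by rewrite mulf_neq0 // expf_neq0.
apply: (mulfI c0); rewrite mulr_sumr.
transitivity (\prod_(i < 2 * n) (q ^+ n + a * q ^+ i)); last first.
  rewrite q_binomial; apply: eq_bigr => j _.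
  have [e1 e2] := @theta_exp_shift n j (ltn_ord j).
  rewrite -exprM [RHS]mulrCA.
  have -> : c * theta_term a b n j =
            q ^+ ('C(j, 2) + n * (2 * n - j)) * a ^+ j.
    rewrite /c /theta_term /q; move: e1 e2.
    set e := (_ + n * _)%N; set e' := (_ + 'C(n, 2))%N => e1 e2.
    transitivity (a ^+ (e' + n + theta_exp n j) * b ^+ (e' + theta_exp j n)).
      by rewrite exprMn !exprD; ring.
    by rewrite -e1 -e2 exprMn exprD; ring.
  by rewrite exprD; ring.
rewrite mul2n -addnn big_split_ord /=.
under [X in _ = _ * X]eq_bigr => i _.
  rewrite exprD mulrCA -[X in X + _]mulr1 -mulrDr.
  over.
have -> : \prod_(i < n) (q ^+ n + a * q ^+ i) =
          a ^+ n * q ^+ 'C(n, 2) * \prod_(i < n) (1 + b * q ^+ i).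
  rewrite [X in _ = _ * X](reindex_inj rev_ord_inj) /=.
  rewrite -bin2_sum -prodrXr big_mkord -[n in a ^+ n]card_ord -prodr_const.
  rewrite -!big_split /=; apply: eq_bigr => i _.
  rewrite mulrDr mulr1 addrC; congr (_ + _).
  rewrite mulrA [_ * b]mulrAC -/q -mulrA -exprD -exprS; congr (_ ^+ _).
  by have := ltn_ord i; lia.
rewrite !big_split /= prodr_const card_ord -exprM /c exprD; ring.
Qed.

Lemma theta_exp_far n j :
  ((j - n) + (n - j) <= theta_exp n j + theta_exp j n)%N.
Proof. by rewrite /theta_exp !binS !bin1; lia. Qed.

(** * Congruences modulo a power of X and the truncated triple product *)

Definition eq_modX (F : fieldType) (M : nat) (u v : {poly F}) : bool :=
  'X^M %| u - v.

Section EqModX.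
Variables (F : fieldType) (M : nat).
Implicit Types u v w : {poly F}.

Lemma eq_modX_refl u : eq_modX M u u.
Proof. by rewrite /eq_modX subrr dvdp0. Qed.

Lemma eq_modX_sym u v : eq_modX M u v = eq_modX M v u.
Proof. by rewrite /eq_modX -opprB dvdpNr. Qed.

Lemma eq_modX_trans v u w : eq_modX M u v -> eq_modX M v w -> eq_modX M u w.
Proof. by move=> h1 h2; rewrite /eq_modX -(subrKA v) dvdp_add. Qed.

Lemma eq_modXD u1 v1 u2 v2 :
  eq_modX M u1 v1 -> eq_modX M u2 v2 -> eq_modX M (u1 + u2) (v1 + v2).
Proof. by move=> h1 h2; rewrite /eq_modX opprD addrACA dvdp_add. Qed.

Lemma eq_modXM u1 v1 u2 v2 :
  eq_modX M u1 v1 -> eq_modX M u2 v2 -> eq_modX M (u1 * u2) (v1 * v2).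
Proof.
move=> h1 h2; rewrite /eq_modX.
have -> : u1 * u2 - v1 * v2 = (u1 - v1) * u2 + v1 * (u2 - v2) by ring.
by rewrite dvdp_add ?(dvdp_mulr _ h1) ?(dvdp_mull _ h2).
Qed.

Lemma eq_modX_sum (I : Type) (r : seq I) (u v : I -> {poly F}) :
  (forall i, eq_modX M (u i) (v i)) ->
  eq_modX M (\sum_(i <- r) u i) (\sum_(i <- r) v i).
Proof.
by move=> h; apply: (big_ind2 (eq_modX M)) => // [|*]; rewrite ?eq_modX_refl ?eq_modXD.
Qed.

Lemma eq_modX_prod (I : Type) (r : seq I) (u v : I -> {poly F}) :
  (forall i, eq_modX M (u i) (v i)) ->
  eq_modX M (\prod_(i <- r) u i) (\prod_(i <- r) v i).
Proof.
by move=> h; apply: (big_ind2 (eq_modX M)) => // [|*]; rewrite ?eq_modX_refl ?eq_modXM.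
Qed.

Lemma eq_modX_coef u v i : eq_modX M u v -> (i < M)%N -> u`_i = v`_i.
Proof.
move=> /dvdpP[w] /(canRL (subrK _)) -> lt_iM.
by rewrite coefD coefMXn lt_iM add0r.
Qed.

Lemma coef_eq_modX u v : (forall i, (i < M)%N -> u`_i = v`_i) -> eq_modX M u v.
Proof.
move=> h; rewrite /eq_modX /dvdp -Pdiv.IdomainMonic.take_poly_modp; apply/eqP/polyP => i.
by rewrite coef_take_poly coefB coef0; case: ltnP => // /h->; rewrite subrr.
Qed.

Lemma eq_modX0 u : eq_modX M u 0 = ('X^M %| u).
Proof. by rewrite /eq_modX subr0. Qed.

(** A polynomial with nonzero constant term is invertible modulo X^M. *)
Lemma eq_modX_cancel w u v : w.[0] != 0 ->
  eq_modX M (w * u) (w * v) -> eq_modX M u v.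
Proof.
move=> w0; rewrite /eq_modX -mulrBr Gauss_dvdpr //.
by rewrite coprimep_expl // coprimep_sym coprimepX.
Qed.

Lemma dvdX_exp u m n : 'X %| u -> (m <= n)%N -> 'X^m %| u ^+ n.
Proof.
by move=> Xu le_mn; apply: dvdp_trans (dvdp_exp2r m Xu) (dvdp_exp2l _ le_mn).
Qed.

Lemma prod_trunc (u : nat -> {poly F}) n :
  (forall i, (M <= i)%N -> eq_modX M (u i) 1) -> (M <= n)%N ->
  eq_modX M (\prod_(i < n) u i) (\prod_(i < M) u i).
Proof.
move=> u1 /subnKC <-; elim: (n - M)%N => [|d IH].
  by rewrite addn0 eq_modX_refl.
rewrite addnS big_ord_recr /= -[X in eq_modX M _ X]mulr1.
by apply: eq_modXM IH (u1 _ _); lia.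
Qed.

Lemma qpoch_trunc (q : {poly F}) n : 'X %| q -> (M <= n)%N ->
  eq_modX M (qpoch q n) (qpoch q M : {poly F}).
Proof.
move=> Xq; apply: (prod_trunc (u := fun i => 1 - q ^+ i.+1)) => i le_Mi.
by rewrite /eq_modX addrAC subrr add0r dvdpNr dvdX_exp // ltnW.
Qed.

Lemma qpoch_at0 (q : {poly F}) n : 'X %| q -> (qpoch q n).[0] = 1.
Proof.
move=> /dvdpP[w ->]; rewrite horner_prod big1 // => i _.
by rewrite !hornerE ?expr0n ?subr0.
Qed.

End EqModX.

(** In the finite triple product, a term whose index is at distance at least
    M from both ends has a Gaussian binomial which is the inverse of (q; q)_n
    modulo X^M, by [gauss_bin_qpoch]; a term closer to an end vanishes modulo
    X^M because its exponent is large, by [theta_exp_far]. *)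
Lemma triple_product_trunc (F : fieldType) (a b : {poly F}) M n :
  'X %| a -> 'X %| b -> a != 0 -> b != 0 -> (2 * M <= n)%N ->
  eq_modX M
    (qpoch (a * b) n *
       \prod_(i < n) ((1 + a * (a * b) ^+ i) * (1 + b * (a * b) ^+ i)))
    (\sum_(j < (2 * n).+1) theta_term a b n j).
Proof.
move=> Xa Xb a0 b0 le_Mn; have Xq : 'X %| a * b by rewrite dvdp_mulr.
rewrite finite_triple_product // mulr_sumr; apply: eq_modX_sum => j.
set q := a * b in Xq *; have le_j := ltn_ord j; rewrite ltnS in le_j.
have Xtheta : ('X^(theta_exp n j + theta_exp j n) %| theta_term a b n j).
  by rewrite exprD dvdp_mul ?dvdX_exp.
have [/andP[le_Mj le_M2]|] := boolP ((M <= j) && (M <= 2 * n - j))%N.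
  rewrite mulrA -[X in eq_modX M _ X]mul1r; apply: eq_modXM (eq_modX_refl _ _).
  have trunc m : (M <= m)%N -> eq_modX M (qpoch q m) (qpoch q n).
    move=> le_Mm; apply: eq_modX_trans (qpoch_trunc Xq le_Mm) _.
    by rewrite eq_modX_sym qpoch_trunc //; lia.
  apply: (@eq_modX_cancel _ _ (qpoch q n)); first by rewrite qpoch_at0 ?oner_eq0.
  rewrite mulr1.
  apply: (@eq_modX_trans _ _ (qpoch q (2 * n))); last by apply: trunc; lia.
  rewrite -(gauss_bin_qpoch q le_j) mulrA mulrC mulrA.
  rewrite eq_modX_sym; do !apply: eq_modXM => //; first exact: eq_modX_refl.
    exact: trunc.
  exact: trunc.
move=> far.
have {}Xtheta : eq_modX M (theta_term a b n j) 0.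
  rewrite eq_modX0; apply: dvdp_trans Xtheta; apply: dvdp_exp2l.
  by have := theta_exp_far n j; lia.
apply: (@eq_modX_trans _ _ 0); last by rewrite eq_modX_sym.
by rewrite mulrA -[X in eq_modX M _ X](mulr0 (qpoch q n * gauss_bin q (2 * n) j))
   eq_modXM ?eq_modX_refl.
Qed.

(** * Enumerating partitions and the series of B *)

Local Open Scope nat_scope.

(** Partitions as nonincreasing lists, with parts among f 0 < ... < f (L-1) and
    each part used fewer than K times: K = 2 gives distinct parts, and K larger
    than the size gives no restriction. The largest part comes first, so adding
    f L means prepending a block of copies of it. *)
Fixpoint part_enum (f : nat -> nat) (K L : nat) : seq (seq nat) :=
  if L is L'.+1 then
    [seq nseq c (f L') ++ s | c <- iota 0 K, s <- part_enum f K L']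
  else [:: [::]].

(** This inverts the recursive step of [part_enum]. *)
Lemma split_largest_part (x : nat) (s : seq nat) :
  sorted geq s -> all (geq x) s ->
  s = nseq (count_mem x s) x ++ [seq y <- s | y != x].
Proof.
move=> srt_s le_sx.
have geq_trans : transitive geq by move=> ? ? ? /= h /leq_trans; apply.
have geq_anti : antisymmetric geq by move=> a b /=; lia.
have <- : [seq y <- s | y == x] = nseq (count_mem x s) x.
  by rewrite -size_filter; apply/all_pred1P/filter_all.
apply: (sorted_eq geq_trans geq_anti srt_s); last first.
  by rewrite perm_sym perm_filterC.
move: srt_s; rewrite !(sorted_pairwise geq_trans) pairwise_cat => srt_s.
rewrite !pairwise_filter // !andbT; apply/allrelP => a b /=.
by rewrite !mem_filter => /andP[/eqP-> _] /andP[_ /(allP le_sx)].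
Qed.

Section PartEnum.
Variables (f : nat -> nat) (K : nat).
Hypotheses (f_incr : {homo f : i j / i < j}) (K_gt0 : 0 < K).

Definition restricted_partition (L : nat) (s : seq nat) : bool :=
  [&& sorted geq s, all (mem [seq f i | i <- iota 0 L]) s
    & all (fun x => count_mem x s < K) s].

Lemma restricted_lt L s x : restricted_partition L s -> x \in s -> x < f L.
Proof.
case/and3P=> _ /allP h _ /h /mapP[i]; rewrite mem_iota => /= lt_iL ->.
exact: f_incr.
Qed.

Lemma mem_map_iotaS L x :
  (x \in [seq f i | i <- iota 0 L.+1]) =
  (x \in [seq f i | i <- iota 0 L]) || (x == f L).
Proof. by rewrite -[L.+1]addn1 iotaD map_cat mem_cat mem_seq1. Qed.

Lemma mem_part_enum L s : (s \in part_enum f K L) = restricted_partition L s.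
Proof.
elim: L s => [|L IH] s.
  by rewrite inE /restricted_partition; case: s => //= x s; case: path.
have geq_trans : transitive geq by move=> ? ? ? /= h /leq_trans; apply.
apply/allpairsP/idP => [[[c s'] /= [c_lt s'P ->]]|sP].
  rewrite mem_iota /= add0n in c_lt; rewrite IH in s'P.
  have lt_s' := restricted_lt s'P.
  have notin : f L \notin s' by apply/negP => /lt_s'; rewrite ltnn.
  case/and3P: s'P => srt al cn; apply/and3P; split.
  - rewrite (sorted_pairwise geq_trans) pairwise_cat -!(sorted_pairwise geq_trans) srt.
    rewrite andbT; apply/andP; split.
      by apply/allrelP => a b /nseqP[-> _] /lt_s' /ltnW.
    by elim: (c) => // -[|d] //= ->; rewrite leqnn.
  - apply/allP => x; rewrite mem_cat /= mem_map_iotaS => /orP[/nseqP[-> _]|/(allP al)/=->//].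
    by rewrite eqxx orbT.
  rewrite all_cat all_nseq count_cat count_nseq /= eqxx mul1n.
  rewrite (count_memPn notin) addn0 c_lt orbT /=; apply/allP => x xs'.
  rewrite count_cat count_nseq /= (_ : f L == x = false); first exact: (allP cn).
  by apply/negbTE; apply: contraNneq notin => ->.
have := sP; case/and3P => srt al cn.
have le_sf : all (geq (f L)) s.
  apply/allP => x /(allP al) /mapP[i]; rewrite mem_iota => /= lt_i -> /=.
  by move: lt_i; rewrite ltnS leq_eqVlt => /orP[/eqP->//|/f_incr/ltnW].
exists (count_mem (f L) s, [seq y <- s | y != f L]); split => /=.
- rewrite mem_iota /= add0n; have [/(allP cn)//|/count_memPn->//] := boolP (f L \in s).
- rewrite IH; apply/and3P; split; first exact: sorted_filter.
    apply/allP => x; rewrite mem_filter => /andP[nx /(allP al)] /=.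
    by rewrite mem_map_iotaS (negbTE nx) orbF.
  apply/allP => x; rewrite mem_filter => /andP[nx /(allP cn)] /=.
  by apply: leq_ltn_trans; rewrite count_filter; apply: sub_count => y /andP[].
exact: split_largest_part.
Qed.

Lemma part_enum_uniq L : uniq (part_enum f K L).
Proof.
elim: L => //= L IH; apply: allpairs_uniq => //; first exact: iota_uniq.
have cnt s : s \in part_enum f K L -> count_mem (f L) s = 0.
  rewrite mem_part_enum => /restricted_lt lt_s.
  by apply/count_memPn/negP => /lt_s; rewrite ltnn.
move=> _ _ /allpairsP[[c s] [/= _ sP ->]] /allpairsP[[d t] [/= _ tP ->]] /= e.
have ecd : c = d.
  move/(congr1 (count_mem (f L))): e.
  by rewrite !count_cat !count_nseq /= eqxx !mul1n !cnt // !addn0.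
by move: e; rewrite ecd => /eqP; rewrite eqseq_cat // eqxx => /eqP->.
Qed.

End PartEnum.

Local Open Scope ring_scope.

Lemma part_enum_gf (R : comNzRingType) (f : nat -> nat) K L :
  \sum_(s <- part_enum f K L) 'X^(sumn s) =
  \prod_(i < L) \sum_(c < K) 'X^(f i * c) :> {poly R}.
Proof.
elim: L => [|L IH] /=; first by rewrite big_ord0 big_seq1.
rewrite big_allpairs_dep big_ord_recr /= -IH mulrC.
rewrite -[X in iota 0 X]subn0 -/(index_iota _ _) big_mkord mulr_suml.
apply: eq_bigr => c _; rewrite mulr_sumr; apply: eq_bigr => s _.
by rewrite sumn_cat sumn_nseq exprD.
Qed.

Definition triple_enum (M : nat) : seq (seq nat * seq nat * seq nat) :=
  let D := part_enum (fun i => i.*2.+1) 2 M in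
  [seq (u, s3) | u <- [seq (s1, s2) | s1 <- D, s2 <- D],
                 s3 <- part_enum (fun i => (4 * i.+1)%N) M M].

Lemma odd_incr : {homo (fun i => i.*2.+1) : i j / (i < j)%N}.
Proof. by move=> i j; lia. Qed.

Lemma four_incr : {homo (fun i => (4 * i.+1)%N) : i j / (i < j)%N}.
Proof. by move=> i j; lia. Qed.

(** For a partition of size less than M this bounds both the parts (a part
    occurs at least once) and the multiplicities (a part is at least 1), so that
    truncating the enumeration at M loses nothing. *)
Lemma leq_mul_count_sumn (s : seq nat) x : (x * count_mem x s <= sumn s)%N.
Proof.
elim: s => [|y s IH] /=; first by rewrite muln0.
by rewrite mulnDr leq_add //; case: eqP => [->|_]; rewrite ?muln1 ?muln0.
Qed.

Lemma odd_partE M s : (sumn s < M)%N ->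
  (s \in part_enum (fun i => i.*2.+1) 2 M) =
  [&& is_partition s, uniq s & all odd s].
Proof.
move=> lt_sM; rewrite (mem_part_enum odd_incr) // /is_partition.
apply/and3P/and3P => [[srt al cn]|[/andP[srt s0] us al]]; split => //.
- rewrite srt; apply/negP => /(allP al) /mapP[i _] //.
- apply: count_mem_uniq => x; have [xs|/count_memPn//] := boolP (x \in s).
  by have := allP cn _ xs; rewrite -has_pred1 has_count in xs; lia.
- by apply/allP => x /(allP al) /mapP[i _ ->] /=; rewrite odd_double.
- apply/allP => x xs; apply/mapP; exists x./2; last first.
    by rewrite -{1}(odd_double_half x) (allP al).
  have := leq_mul_count_sumn s x; rewrite count_uniq_mem // xs mem_iota; lia.
by apply/allP => x xs; rewrite count_uniq_mem // xs.
Qed.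

Lemma four_partE M s : (sumn s < M)%N ->
  (s \in part_enum (fun i => (4 * i.+1)%N) M M) =
  is_partition s && all (dvdn 4) s.
Proof.
move=> lt_sM; rewrite (mem_part_enum four_incr) ?(leq_ltn_trans _ lt_sM) // /is_partition.
have pos x : x \in s -> (0 < count_mem x s)%N by rewrite -has_count has_pred1.
apply/and3P/andP => [[srt al cn]|[/andP[srt s0] al]]; split => //.
- by rewrite srt; apply/negP => /(allP al) /mapP[i _] //.
- by apply/allP => x /(allP al) /mapP[i _ ->] /=; rewrite dvdn_mulr.
- apply/allP => x xs; apply/mapP; exists (x %/ 4).-1.
    have := leq_mul_count_sumn s x; have := pos _ xs; rewrite mem_iota; nia.
  have x0 : (0 < x)%N by rewrite lt0n; apply: contraNneq s0 => <-.
  by have := allP al _ xs => /= d4; lia.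
apply/allP => x xs; have x0 : (0 < x)%N by rewrite lt0n; apply: contraNneq s0 => <-.
by have := leq_mul_count_sumn s x; nia.
Qed.

Lemma B_triple_enum M m : (m < M)%N ->
  B m = count (fun t => sumn t.1.1 + sumn t.1.2 + sumn t.2 == m)%N (triple_enum M).
Proof.
move=> lt_mM; rewrite -size_filter; apply: B_enum.
  apply: filter_uniq; apply: allpairs_uniq => [||[? ?] [? ?] _ _ /= [-> ->]] //.
    apply: allpairs_uniq => [||[? ?] [? ?] _ _ /= [-> ->]] //;
      by rewrite part_enum_uniq //; apply: odd_incr.
  by apply: part_enum_uniq; [apply: four_incr|lia].
move=> [[s1 s2] s3]; rewrite mem_filter /=.
have -> : ((s1, s2, s3) \in partition_triple m) =
  [&& is_partition s1, is_partition s2, is_partition s3,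
      uniq s1 && all odd s1, uniq s2 && all odd s2, all (dvdn 4) s3
    & sumn s1 + sumn s2 + sumn s3 == m]%N by [].
have [sm|/negbTE ne] := boolP (_ == m); last by rewrite !andbF.
have -> : ((s1, s2, s3) \in triple_enum M) =
  [&& s1 \in part_enum (fun i => i.*2.+1) 2 M,
      s2 \in part_enum (fun i => i.*2.+1) 2 M
    & s3 \in part_enum (fun i => (4 * i.+1)%N) M M].
  apply/allpairsP/and3P => [[[u ?] /= [/allpairsP[[? ?] /= [? ? ->]] ? [-> -> ->]]]|[h1 h2 h3]] //.
  exists ((s1, s2), s3); split => //=; apply/allpairsP; by exists (s1, s2).
by rewrite !odd_partE ?four_partE; lia.
Qed.

(** Distinct parts contribute a factor with the two choices 0 and 1 for the
    multiplicity. *)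
Lemma triple_enum_gf (R : comNzRingType) M :
  \sum_(t <- triple_enum M) 'X^(sumn t.1.1 + sumn t.1.2 + sumn t.2) =
  (\prod_(i < M) (1 + 'X^(i.*2.+1))) ^+ 2 *
    \prod_(i < M) \sum_(c < M) 'X^(4 * i.+1 * c) :> {poly R}.
Proof.
rewrite /triple_enum !big_allpairs_dep /= -(part_enum_gf R (fun i => (4 * i.+1)%N)).
have -> : \prod_(i < M) (1 + 'X^(i.*2.+1)) =
    \sum_(s <- part_enum (fun i => i.*2.+1) 2 M) 'X^(sumn s) :> {poly R}.
  rewrite part_enum_gf; apply: eq_bigr => i _.
  by rewrite big_ord_recl big_ord1 muln0 muln1.
rewrite expr2 big_distrlr /= mulr_suml; apply: eq_bigr => s1 _.
rewrite mulr_suml; apply: eq_bigr => s2 _.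
by rewrite mulr_sumr; apply: eq_bigr => s3 _; rewrite !exprD.
Qed.

(** Each geometric sum over the multiplicities of 4(i+1), multiplied by
    1 - X^(4(i+1)), telescopes to 1 up to a term of degree at least M. *)
Lemma B_gf_trunc (F : fieldType) M :
  eq_modX M (\poly_(m < M) (B m)%:R * qpoch 'X^4 M)
    ((\prod_(i < M) (1 + 'X^(i.*2.+1))) ^+ 2 : {poly F}).
Proof.
set D : {poly F} := \prod_(i < M) _.
set A : {poly F} := \prod_(i < M) \sum_(c < M) 'X^(4 * i.+1 * c).
have BE : eq_modX M (\poly_(m < M) (B m)%:R) (D ^+ 2 * A).
  apply: coef_eq_modX => m lt_mM; rewrite coef_poly lt_mM (B_triple_enum lt_mM).
  rewrite -triple_enum_gf coef_sum -sum1_count natr_sum big_mkcond /=.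
  by apply: eq_bigr => t _; rewrite coefXn eq_sym; case: eqP.
apply: eq_modX_trans (eq_modXM BE (eq_modX_refl _ _)) _.
rewrite -mulrA -[X in eq_modX M _ X]mulr1; apply: eq_modXM (eq_modX_refl _ _) _.
rewrite /A /qpoch -big_split /=.
rewrite [X in eq_modX M _ X](_ : 1 = \prod_(i < M) (1 : {poly F})); last by rewrite big1.
apply: eq_modX_prod => i; set y : {poly F} := 'X^4 ^+ i.+1.
under eq_bigr do rewrite exprM exprM -/y.
rewrite mulrC -opprB mulNr -subrX1 opprB /eq_modX addrAC subrr add0r dvdpNr.
by rewrite /y -!exprM; apply: dvdp_exp2l; nia.
Qed.

(** * Pentagonal and triangular numbers *)

Lemma theta_exp_int n j :
  (2 * (theta_exp n j)%:Z = (j%:Z - n%:Z) * (j%:Z - n%:Z + 1))%R.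
Proof.
rewrite /theta_exp.
case: (leqP n j) => [le_nj|/ltnW le_jn].
  have [d ->] : exists d, j = (d + n)%N by exists (j - n)%N; lia.
  have -> : (n - (d + n) = 0)%N by lia.
  by rewrite addnK (@bin_small 0) //; have := bin2_double d.+1; lia.
have [d ->] : exists d, n = (d + j)%N by exists (n - j)%N; lia.
have -> : (j - (d + j) = 0)%N by lia.
by rewrite addnK (@bin_small 1) //; have := bin2_double d; lia.
Qed.

(** The triple product at a = -y^2, b = -y: the factors 1 - y^e with e
    congruent to 0, 1, 2 modulo 3 together make up (y; y). *)
Lemma pentagonal_trunc (F : fieldType) (y : {poly F}) M n :
  'X %| y -> y != 0 -> (2 * M <= n)%N ->
  eq_modX M (qpoch y M)
    (\sum_(j < (2 * n).+1) theta_term (- y ^+ 2) (- y) n j).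
Proof.
move=> Xy y0 le_Mn.
apply: (@eq_modX_trans _ _ (qpoch y (3 * n))).
  by rewrite eq_modX_sym qpoch_trunc //; lia.
have -> : qpoch y (3 * n) = qpoch (- y ^+ 2 * - y) n *
  \prod_(i < n) ((1 + - y ^+ 2 * (- y ^+ 2 * - y) ^+ i) *
                 (1 + - y * (- y ^+ 2 * - y) ^+ i)).
  have -> : - y ^+ 2 * - y = y ^+ 3 by ring.
  elim: (n) => [|m IH]; first by rewrite muln0 /qpoch !big_ord0 mulr1.
  rewrite mulnSr /qpoch !addnS addn0 !big_ord_recr /= -/(qpoch y _) IH -/(qpoch _ m).
  set c := \prod_(i < m) _; set d := qpoch _ m.
  have -> : y ^+ 3 ^+ m.+1 = y ^+ 3 * y ^+ (3 * m) by rewrite exprS -exprM.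
  have -> : y ^+ 3 ^+ m = y ^+ (3 * m) by rewrite -exprM.
  have eS k : y ^+ (3 * m + k) = y ^+ k * y ^+ (3 * m) by rewrite exprD mulrC.
  rewrite -[(3 * m).+3]addn3 -[(3 * m).+2]addn2 -[(3 * m).+1]addn1 !eS; ring.
by apply: triple_product_trunc; rewrite ?dvdpNr ?dvdp_exp ?oppr_eq0 ?expf_neq0.
Qed.

(** The triple product at a = y^3, b = y: the factors 1 + y^e with e congruent
    to 1 or 3 modulo 4 together run over all odd e. *)
Lemma triangular_trunc (F : fieldType) (y : {poly F}) M n :
  'X %| y -> y != 0 -> (2 * M <= n)%N ->
  eq_modX M (qpoch (y ^+ 4) M * \prod_(i < M) (1 + y ^+ i.*2.+1))
    (\sum_(j < (2 * n).+1) theta_term (y ^+ 3) y n j).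
Proof.
move=> Xy y0 le_Mn.
have X3 : 'X %| y ^+ 3 by rewrite dvdp_exp.
have X4 : 'X %| y ^+ 4 by rewrite dvdp_exp.
have trunc : eq_modX M (\prod_(i < 2 * n) (1 + y ^+ i.*2.+1))
                       (\prod_(i < M) (1 + y ^+ i.*2.+1)).
  apply: (@prod_trunc _ _ (fun i => 1 + y ^+ i.*2.+1)); last by lia.
  move=> i le_Mi; rewrite /eq_modX addrAC subrr add0r dvdX_exp //; lia.
have le_Mn' : (M <= n)%N by lia.
apply: (@eq_modX_trans _ _ (qpoch (y ^+ 4) n * \prod_(i < 2 * n) (1 + y ^+ i.*2.+1))).
  by rewrite eq_modX_sym; apply: eq_modXM trunc; apply: qpoch_trunc.
have -> : \prod_(i < 2 * n) (1 + y ^+ i.*2.+1) =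
  \prod_(i < n) ((1 + y ^+ 3 * (y ^+ 3 * y) ^+ i) * (1 + y * (y ^+ 3 * y) ^+ i)).
  elim: (n) => [|m IH]; first by rewrite muln0 !big_ord0.
  rewrite mulnSr !addnS addn0 !big_ord_recr /= IH -mulrA; congr (_ * _).
  have -> : (y ^+ 3 * y) ^+ m = y ^+ (2 * m).*2.
    by rewrite -exprSr -exprM; congr (_ ^+ _); lia.
  by rewrite doubleS !exprS; ring.
rewrite [y ^+ 4]exprSr.
by apply: triple_product_trunc; rewrite ?expf_neq0.
Qed.

Lemma qpoch_frobenius (R : comNzRingType) (q : R) p n : p \in [pchar R] ->
  qpoch q n ^+ p = qpoch (q ^+ p) n.
Proof.
move=> pR; rewrite /qpoch -prodrXl; apply: eq_bigr => i _.
rewrite -(pFrobenius_autE pR) pFrobenius_autB_comm; last exact: mulrC.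
by rewrite pFrobenius_aut1 pFrobenius_autE -!exprM mulnC.
Qed.

(** The congruence on which everything rests: with f_12 = f_4^3 modulo 3, the
    pentagonal series times the series of B is f_4^2 (f_4 * series of B)
    = (f_4 D)^2, the square of the triangular series. *)
Lemma pentagonal_B_gf (F : fieldType) M n : 3%N \in [pchar F] ->
  (2 * M <= n)%N ->
  eq_modX M
    ((\sum_(j < (2 * n).+1) theta_term (- 'X^12 ^+ 2) (- 'X^12) n j) *
     \poly_(m < M) (B m)%:R)
    ((\sum_(j < (2 * n).+1) theta_term ('X ^+ 3) 'X n j) ^+ 2 : {poly F}).
Proof.
move=> char3 le_Mn.
have char3X : 3%N \in [pchar {poly F}] by rewrite pchar_poly.
set g := \poly_(m < M) _.
have X12 : 'X %| ('X^12 : {poly F}) by rewrite dvdp_exp.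
have X12_0 : 'X^12 != 0 :> {poly F} by rewrite expf_neq0 // polyX_eq0.
have X0 : 'X != 0 :> {poly F} by rewrite polyX_eq0.
set s1 := (X in X * g); set s2 := (X in X ^+ 2).
set Q : {poly F} := qpoch 'X^4 M; set D : {poly F} := \prod_(i < M) (1 + 'X ^+ i.*2.+1).
have e1 : eq_modX M s1 (Q ^+ 3).
  rewrite eq_modX_sym /Q qpoch_frobenius // -exprM.
  exact: pentagonal_trunc.
have e2 : eq_modX M (Q * D) s2 by apply: triangular_trunc.
apply: eq_modX_trans (eq_modXM e1 (eq_modX_refl _ _)) _.
have -> : Q ^+ 3 * g = Q ^+ 2 * (g * Q) by ring.
apply: eq_modX_trans (eq_modXM (eq_modX_refl _ _) (B_gf_trunc _ _)) _.
by rewrite -exprMn; apply: eq_modXM.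
Qed.

(** If p does not divide x, then u^2 = -v^2 for nonzero u, v in 'F_p; raising to
    the odd power (p-1)/2 and applying Fermat gives 1 = -1. *)
Lemma dvdz_sum_squares (p : nat) (x y : int) : prime p -> (p = 3 %[mod 4])%N ->
  (p%:Z %| x ^+ 2 + y ^+ 2)%Z -> (p%:Z %| x)%Z.
Proof.
move=> p_pr p3; rewrite !(dvdz_pcharf (pchar_Fp p_pr)) rmorphD /= !rmorphXn /=.
set u : 'F_p := x%:~R; set v : 'F_p := y%:~R => /eqP/addr0_eq/esym uv.
apply: contraTT isT => u0.
have v0 : v != 0.
  apply: contraNneq u0 => v0; move: uv; rewrite v0 expr0n /= => /eqP.
  by rewrite eq_sym oppr_eq0 expf_eq0.
(* As p = 4 (p %/ 4) + 3, the exponent here is p - 1 = 2 (p - 1)/2. *)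
have fermat (w : 'F_p) : w != 0 -> w ^+ (p %/ 4).*2.+1 ^+ 2 = 1.
  move=> w0; apply: (mulfI w0); rewrite mulr1 -exprM -exprS.
  rewrite -[RHS]expf_card card_Fp //; congr (_ ^+ _); lia.
have := fermat v v0; rewrite -exprM mulnC exprM uv.
rewrite exprNn -exprM mulnC exprM fermat // mulr1 exprS -mul2n exprM sqrrN expr1n expr1n mulr1.
move=> /eqP; rewrite eq_sym -subr_eq0 opprK -(natrD _ 1 1) -(dvdn_pcharf (pchar_Fp p_pr)).
rewrite dvdn_divisors // !inE => /orP[]/eqP; lia.
Qed.

(** * Vanishing of the alternating sum *)

Lemma theta_expZ n j :
  (theta_exp n j * 24 + theta_exp j n * 12)%:Z =
  6 * (j%:Z - n%:Z) * (3 * (j%:Z - n%:Z) + 1).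
Proof. by have := theta_exp_int n j; have := theta_exp_int j n; lia. Qed.

(** The sign is (-1)^(k^2) = (-1)^k, where k = j - n. *)
Lemma theta_term_pentagonal (F : fieldType) n j :
  theta_term (- 'X^12 ^+ 2) (- 'X^12) n j =
  (((-1) ^ (j%:Z - n%:Z) : int)%:~R : F)%:P * 'X^(theta_exp n j * 24 + theta_exp j n * 12).
Proof.
set e := theta_exp n j; set e' := theta_exp j n.
have sgn : ((-1) ^ (j%:Z - n%:Z) : int) = (-1) ^+ (e + e').
  have := theta_exp_int n j; have := theta_exp_int j n; rewrite -/e -/e' => e2' e2.
  have -> : (e + e' = `|j%:Z - n%:Z| * `|j%:Z - n%:Z|)%N by nia.
  by rewrite expN1r -[in RHS]signr_odd oddM andbb signr_odd.
rewrite sgn !rmorphXn !rmorphN1 /theta_term -/e -/e'.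
rewrite [(- 'X^12 ^+ 2) ^+ e]exprNn [(- 'X^12) ^+ e']exprNn mulrACA -exprD.
rewrite -!(exprM 'X) -exprD; congr (_ * 'X^_); lia.
Qed.

(** Completing the square: 8(2k^2 + k) + 1 = (4k+1)^2. *)
Lemma coef_triangular_square (F : fieldType) (n N : nat) :
  (forall x y : int, x ^+ 2 + y ^+ 2 != 8 * N%:Z + 2) ->
  ((\sum_(j < (2 * n).+1) theta_term ('X ^+ 3) 'X n j) ^+ 2 : {poly F})`_N = 0.
Proof.
move=> no_rep; rewrite expr2 big_distrlr /= coef_sum big1 // => i _.
rewrite coef_sum big1 // => j _; rewrite /theta_term -!exprM -!exprD coefXn.
case: eqP => // eN; have /eqP[] := no_rep (4 * (i%:Z - n%:Z) + 1) (4 * (j%:Z - n%:Z) + 1).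
have := theta_exp_int n i; have := theta_exp_int i n.
by have := theta_exp_int n j; have := theta_exp_int j n; lia.
Qed.

Local Open Scope classical_set_scope.
Local Open Scope ring_scope.

(** The support of the sum lies in [-n, n] with n = 2(N+1), which is also large
    enough for the truncated identities modulo X^(N+1). *)
Lemma alternating_B_sum (N : nat) :
  (forall x y : int, x ^+ 2 + y ^+ 2 != 8 * N%:Z + 2) ->
  (3 %| \sum_(k \in [set: int]) (-1) ^ k * Bz (N%:Z - 6 * k * (3 * k + 1)))%Z.
Proof.
move=> no_rep; set n := (2 * N.+1)%N.
set r := [seq j%:Z - n%:Z | j <- iota 0 (2 * n).+1].
have ur : uniq r by rewrite map_inj_uniq ?iota_uniq // => i j /addIr [].
rewrite -(@fsbig_widen _ _ _ _ [set` r]) //; last first.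
  move=> k [_ /= nr]; apply/eqP.
  suff -> : Bz (N%:Z - 6 * k * (3 * k + 1)) = 0 by rewrite mulr0.
  suff : N%:Z - 6 * k * (3 * k + 1) < 0 by case: (_ - _).
  rewrite ltNge; apply/negP => ge0; apply: nr.
  have ka : - n%:Z <= k <= n%:Z by rewrite /n; nia.
  by apply/mapP; exists `|((k : int) + n%:Z)%R|%N; [rewrite mem_iota|]; lia.
rewrite -fsbig_seq // (dvdz_pcharf (pchar_Fp (isT : prime 3))).
have := eq_modX_coef (pentagonal_B_gf (M := N.+1) (n := n) (pchar_Fp (isT : prime 3)) (leqnn _)) (ltnSn N).
rewrite coef_triangular_square // => coef0; apply/eqP; rewrite -[RHS]coef0.
rewrite mulr_suml coef_sum rmorph_sum /= big_map -[X in iota 0 X]subn0 -/(index_iota _ _) big_mkord.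
apply: eq_bigr => j _; rewrite theta_term_pentagonal -[in RHS]mulrA coefCM coefXnM coef_poly.
rewrite rmorphM /=; congr (_ * _).
rewrite -theta_expZ; set e := (_ + _)%N.
case: ltnP => [lt_Ne|le_eN].
  have : N%:Z - e%:Z < 0 by lia.
  by case: (_ - _).
by rewrite subzn // ltnS leq_subr.
Qed.

Theorem theorem1p4 (p n r : nat) (hp : prime p) (hp4 : (p = 3 %[mod 4])%N)
    (hp5 : (5 <= p)%N) (hr1 : (1 <= r)%N) (hrp : (r <= p - 1)%N) :
  (\sum_(k \in [set: int])
     ((-1) ^ k * Bz (9 * p%:Z ^+ 2 * n%:Z + 9 * p%:Z * r%:Z
                     + ((9 * (p%:Z ^+ 2 - 1)) %/ 4)%Z + 2
                     - 6 * k * (3 * k + 1))) = 0 %[mod 3])%Z.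
Proof.
set c := ((9 * (p%:Z ^+ 2 - 1)) %/ 4)%Z.
have c4 : c * 4 = 9 * (p%:Z ^+ 2 - 1).
  rewrite /c; have [t ->] : exists t, p = (4 * t + 3)%N by exists (p %/ 4)%N; lia.
  by rewrite (_ : 9 * _ = (36 * t%:Z ^+ 2 + 54 * t%:Z + 18) * 4) ?mulzK //; lia.
pose N := `|(9 * p%:Z ^+ 2 * n%:Z + 9 * p%:Z * r%:Z + c + 2)%R|%N.
have NE : 9 * p%:Z ^+ 2 * n%:Z + 9 * p%:Z * r%:Z + c + 2 = N%:Z by rewrite /N; nia.
rewrite NE; apply/eqP; rewrite eqz_mod_dvd subr0; apply: alternating_B_sum => x y.
apply/eqP => xy.
(* The second factor is prime to p, since p does not divide 72r. *)
have eN : 8 * N%:Z + 2 = p%:Z * (p%:Z * (72 * n%:Z + 18) + 72%:Z * r%:Z) by lia.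
have px : (p%:Z %| x)%Z.
  by apply: (@dvdz_sum_squares p x y hp hp4); rewrite xy eN dvdz_mulr.
have py : (p%:Z %| y)%Z.
  by apply: (@dvdz_sum_squares p y x hp hp4); rewrite addrC xy eN dvdz_mulr.
have : (p%:Z %| p%:Z * (72 * n%:Z + 18) + 72%:Z * r%:Z)%Z.
  rewrite -(@dvdz_mul2l p%:Z); last by lia.
  by rewrite -eN -xy; apply: rpredD; rewrite expr2 dvdz_mul.
rewrite (rpredDl _ (dvdz_mulr (72 * n%:Z + 18) (dvdzz p%:Z))).
rewrite -PoszM dvdzE /= Euclid_dvdM // => /orP[|/dvdn_leq]; last by lia.
rewrite (_ : 72 = 2 ^ 3 * 3 ^ 2)%N // Euclid_dvdM // !Euclid_dvdX // !dvdn_prime2 //; lia.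
Qed.
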